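(* Consider the remote-estimation Markov decision process described in the context. The optimal policy $\pi^*$, if it exists (as a stationary deterministic policy attaining the minimum in the Bellman equation $\mathcal{L}^*+h(s)=\min_{a\in\{0,1\}}\{l(s,a)+\sum_{s'}P_{s,s'}(a)h(s')\}$), exhibits a switching structure: for each estimation error $(i,j)$, $i\ne j$, there is a threshold $\tau^*_{i,j}\in\{1,2,\dots\}\cup\{\infty\}$ such that for $s=(i,j,\delta)$, $$\pi^*(s)=\begin{cases}1,&\delta\ge\tau^*_{i,j},\\0,&\text{otherwise,}\end{cases}$$ and $\pi^*(s)=0$ for synced states $s=(i,i,0)$. Here $\tau^*_{i,j}=1$ means always transmitting in error $(i,j)$ and $\tau^*_{i,j}=\infty$ means never transmitting.
   Context: Model. A source $\{X_t\}_{t\ge1}$ is a homogeneous discrete-time Markov chain on $\mathcal{X}=\{1,\dots,M\}$ with irreducible transition matrix $Q=(Q_{i,j})$. Let $\mathcal{X}_{\rm ap}=\{i: Q_{i,i}>0\}$, $\mathcal{X}_{\rm p}=\mathcal{X}\setminus\mathcal{X}_{\rm ap}$; assume $\mathcal{X}_{\rm ap}\ne\emptyset$. At each time $t$ a sensor chooses $A_t\in\{0,1\}$ (1 = transmit). The channel is i.i.d. Bernoulli $H_t$ with $\Pr[H_t=1]=p_s$, $p_f=1-p_s$, independent of the source. The estimate evolves as $\hat X_{t+1}=X_t$ if $A_t=1,H_t=1$, else $\hat X_{t+1}=\hat X_t$. The AoCE is $\Delta_t=\Delta_{t-1}+1$ if $X_t\ne\hat X_t$ and $(X_t,\hat X_t)=(X_{t-1},\hat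 X_{t-1})$; $\Delta_t=1$ if $X_t\ne\hat X_t$ and $(X_t,\hat X_t)\ne(X_{t-1},\hat X_{t-1})$; $\Delta_t=0$ if $X_t=\hat X_t$. State $S_t=(X_t,\hat X_t,\Delta_t)$ with state space $\mathcal{S}=\{(i,i,0)\}\cup\{(i,j,\delta): i\ne j,i\in\mathcal{X}_{\rm ap},\delta\ge1\}\cup\{(i,j,1):i\ne j,i\in\mathcal{X}_{\rm p}\}$. Transition probabilities $P_{s,s'}(a)$: for $s=(i,j,\delta)$, $i\ne j$, under $a=0$: to $(i,j,\delta+1)$ w.p. $Q_{i,i}$, to $(j,j,0)$ w.p. $Q_{i,j}$, to $(k,j,1)$ w.p. $Q_{i,k}$ ($k\ne i,j$); under $a=1$: to $(i,i,0)$ w.p. $Q_{i,i}p_s$, to $(k,i,1)$ w.p. $Q_{i,k}p_s$ ($k\ne i$), to $(i,j,\delta+1)$ w.p. $Q_{i,i}p_f$, to $(j,j,0)$ w.p. $Q_{i,j}p_f$, to $(k,j,1)$ w.p. $Q_{i,k}p_f$ ($k\ne i,j$). For $s=(i,i,0)$ and any $a$: to $(i,i,0)$ w.p. $Q_{i,i}$, to $(k,i,1)$ w.p. $Q_{i,k}$ ($k\ne i$). Costs: constants $D_{i,j}>0$ for $i\ne j$ and non-negative, non-decreasing, possibly unbounded age functions $g_{i,j}$; $c(i,j,\delta)=D_{i,j}g_{i,j}(\delta)$ for $i\ne j$, $c(i,i,0)=0$; per-stage cost $l(s,a)=c(s)+\lambda\mathbb{1}\{a\ne0\}$ with $\lambda\ge0$.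 A policy chooses $A_t$ as a (possibly randomized) function of the history $(X_{1:t},\hat X_{1:t},A_{1:t-1})$; average cost $\mathcal{L}(\pi)=\limsup_{T\to\infty}\frac1T\sum_{t=1}^T\mathbb{E}^\pi[l(S_t,A_t)\mid S_1=s_1]$; a policy is optimal if it attains $\mathcal{L}^*=\inf_\pi\mathcal{L}(\pi)$. *)

(* Defs.v *)
From HB Require Import structures.
From mathcomp Require Import all_boot all_order all_algebra.
From mathcomp Require Import all_classical all_reals all_analysis.
Set Implicit Arguments. Unset Strict Implicit. Unset Printing Implicit Defensive.
Import Order.TTheory GRing.Theory Num.Theory.
Local Open Scope ring_scope.
Local Open Scope classical_set_scope.

Section RemoteEstimation.
Variables (R : realType) (M : nat).

(* A state s = (X_t, Xhat_t, Delta_t). *)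
Definition state := ('I_M * 'I_M * nat)%type.
Definition sX (s : state) : 'I_M := s.1.1.
Definition sXh (s : state) : 'I_M := s.1.2.
Definition sD (s : state) : nat := s.2.

Definition stochastic (Q : 'M[R]_M) :=
  (forall i j, 0 <= Q i j) /\ (forall i, \sum_(j < M) Q i j = 1).

Definition irreducible (Q : 'M[R]_M) :=
  forall i j : 'I_M, exists n : nat, 0 < (iter n (mulmx Q) 1%:M) i j.

Definition in_Xap (Q : 'M[R]_M) (i : 'I_M) := 0 < Q i i.

Definition valid_state (Q : 'M[R]_M) (s : state) : Prop :=
  (sX s = sXh s /\ sD s = 0%N) \/
  (sX s <> sXh s /\ (1 <= sD s)%N /\ (~ in_Xap Q (sX s) -> sD s = 1%N)).

(* Next state when the source moves to k and the new estimate is e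
   (AoCE update rule of the paper). *)
Definition step (s : state) (k e : 'I_M) : state :=
  (k, e, if k == e then 0%N
         else if (k == sX s) && (e == sXh s) then (sD s).+1 else 1%N).

Definition EP (Q : 'M[R]_M) (ps : R) (s : state) (a : bool) (f : state -> R) : R :=
  \sum_(k < M) Q (sX s) k *
     (if a then ps * f (step s k (sX s)) + (1 - ps) * f (step s k (sXh s))
      else f (step s k (sXh s))).

Definition cost (D : 'I_M -> 'I_M -> R) (g : 'I_M -> 'I_M -> nat -> R)
  (s : state) : R :=
  if sX s == sXh s then 0 else D (sX s) (sXh s) * g (sX s) (sXh s) (sD s).

Definition stage_cost D g (lam : R) (s : state) (a : bool) : R :=
  cost D g s + lam * (nat_of_bool a)%:R.

Definition Qfac Q ps D g lam (h : state -> R) (s : state) (a : bool) : R :=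
  stage_cost D g lam s a + EP Q ps s a h.

Definition bellman Q ps D g lam (Lbar : R) (h : state -> R) : Prop :=
  forall s, valid_state Q s ->
    Lbar + h s = Num.min (Qfac Q ps D g lam h s false) (Qfac Q ps D g lam h s true).

Definition attains_min Q ps D g lam (h : state -> R) (sigma : state -> bool) :=
  forall s, valid_state Q s ->
    Qfac Q ps D g lam h s (sigma s) =
    Num.min (Qfac Q ps D g lam h s false) (Qfac Q ps D g lam h s true).

(* General (history dependent, randomized) policies: given the past
   history of (state, action) pairs and the current state, the probability
   of transmitting. *)
Definition policy := seq (state * bool) -> state -> R.
Definition admissible (pi : policy) := forall hs s, 0 <= pi hs s <= 1.

Definition stationary (sigma : state -> bool) : policy :=
  fun _ s => (nat_of_bool (sigma s))%:R.

Fixpoint exp_cost Q ps D g lam (pi : policy) (T : nat)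
  (hs : seq (state * bool)) (s : state) : R :=
  match T with
  | 0 => 0
  | T'.+1 =>
      (1 - pi hs s) *
        (stage_cost D g lam s false +
         EP Q ps s false (exp_cost Q ps D g lam pi T' (rcons hs (s, false))))
    + pi hs s *
        (stage_cost D g lam s true +
         EP Q ps s true (exp_cost Q ps D g lam pi T' (rcons hs (s, true))))
  end.

Definition avg_cost Q ps D g lam (pi : policy) (s1 : state) : \bar R :=
  limn_esup (fun T : nat => ((exp_cost Q ps D g lam pi T [::] s1) / T%:R)%:E).

Definition opt_cost Q ps D g lam (s1 : state) : \bar R :=
  ereal_inf [set avg_cost Q ps D g lam pi s1 | pi in admissible].

Definition optimal_sd Q ps D g lam (sigma : state -> bool) :=
  forall s1, valid_state Q s1 ->
    avg_cost Q ps D g lam (stationary sigma) s1 = opt_cost Q ps D g lam s1.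

Definition threshold_policy (tau : 'I_M -> 'I_M -> option nat) : state -> bool :=
  fun s => if sX s == sXh s then false
           else match tau (sX s) (sXh s) with
                | Some t => (t <= sD s)%N
                | None => false
                end.

End RemoteEstimation.

(* Main.v *)
(* Vanishing discount. The given solution h of the optimality equation need not
   be monotone in the age, since functions growing like Q i i ^- d can be added
   to it, so a monotone solution is constructed afresh. The a-discounted value
   is a limit of value iterations started at 0 and is therefore nondecreasing in
   the age. Once its differences to a reference value are bounded uniformly in
   a, their limits along an ultrafilter a -> 1 solve the optimality equation with
   gains rho e <= Lbar (a priori depending on the estimate e if ps = 0). The
   limit is bounded below, so the minimizing policy costs at most rho e, whence
   rho e = Lbar and this policy is optimal. Monotonicity in the age makes it a
   threshold policy.

   For ps > 0 the differences are bounded by steering to a reference state while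
   always transmitting, which requires a sojourn in an error (i, j) under
   transmission to have finite expected cost; this is where h and the optimal
   policy enter. For ps = 0 a Harnack-type argument bounds them. *)
Require Import Defs.
From HB Require Import structures.
From mathcomp Require Import all_boot all_order all_algebra.
From mathcomp Require Import all_classical all_reals all_analysis.
From mathcomp Require Import ring lra.
Import Order.TTheory GRing.Theory Num.Theory.
Import numFieldNormedType.Exports.
Set Implicit Arguments.
Unset Strict Implicit.
Unset Printing Implicit Defensive.
Local Open Scope classical_set_scope.
Local Open Scope ring_scope.

(** * Limits, Abel summation and linear growth *)

Section RealSequences.
Variable R : realType.
Implicit Types (T : Type) (A K a L : R).

Lemma cvg_minr T (F : set_system T) {FF : Filter F} (f g : T -> R) (x y : R) :
  f t @[t --> F] --> x -> g t @[t --> F] --> y ->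
  Num.min (f t) (g t) @[t --> F] --> Num.min x y.
Proof.
move=> fx gy; rewrite minr_absE; under eq_fun do rewrite minr_absE.
apply: cvgM; last exact: cvg_cst.
apply: cvgB; first exact: cvgD.
by apply: cvg_norm; exact: cvgB.
Qed.

Lemma cvg_sumr T (F : set_system T) {FF : Filter F} (I : finType)
    (f : T -> I -> R) (x : I -> R) :
  (forall i, f t i @[t --> F] --> x i) ->
  \sum_i f t i @[t --> F] --> \sum_i x i.
Proof.
by move=> fx; apply: cvg_big => // z; exact: add_continuous.
Qed.

(** The image ultrafilter has a cluster point in the compact segment, and an ultrafilter converges
    to each of its cluster points. *)
Lemma cvg_ultra_bounded T (U : set_system T) (f : T -> R) K :
  UltraFilter U -> (forall t, `|f t| <= K) -> exists l : R, f t @[t --> U] --> l.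
Proof.
move=> UU fK; have UP := @ultra_proper _ _ UU.
have [] := @segment_compact R (- K) K (fmap f U) _.
  suff -> : fmap f U [set` `[(- K), K]] = U setT by exact: filterT.
  congr U; apply/seteqP; split => // t _ /=.
  by rewrite in_itv /= -ler_norml.
move=> l [_ lf]; exists l => B lB.
have [//|nB] := in_ultra_setVsetC (f @^-1` B) UU.
by have [t [/= nBt Bt]] := lf (~` B) B nB lB.
Qed.

(** [w] is the discounted sum of the increments of [c]; it is summed by parts against the
    nonnegative slack [A * n%:R + K - c n]. *)
Lemma abel_bound (w c : nat -> R) a A K : 0 <= a -> a < 1 ->
  w 0%N = 0 -> c 0%N = 0 ->
  (forall n, w n.+1 = w n + a ^+ n * (c n.+1 - c n)) ->
  (forall n, c n <= A * n%:R + K) -> 0 <= A ->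
  forall n, (1 - a) * w n <= A + (1 - a) * K.
Proof.
move=> a0 a1 w0 c0 wS cle A0 n.
have K0 : 0 <= K by have := cle 0%N; rewrite c0; lra.
(* Keeping the slack closes the induction: each step changes the gap between the sides by
   [(1 - a) ^+ 2 * a ^+ n] times the next slack. *)
suff: (1 - a) * w n <= A * (1 - a ^+ n) + (1 - a) * (K - a ^+ n * (A * n%:R + K - c n)).
  have an0 : 0 <= a ^+ n by exact: exprn_ge0.
  have h1 : 0 <= a ^+ n * (A * n%:R + K - c n).
    by rewrite mulr_ge0// subr_ge0.
  have h2 : 0 <= A * a ^+ n by exact: mulr_ge0.
  have h3 : 0 <= (1 - a) * (a ^+ n * (A * n%:R + K - c n)).
    by rewrite mulr_ge0// subr_ge0 ltW.
  lra.
elim: n => [|n IH]; first by rewrite w0 c0; lra.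
rewrite wS exprS -natr1.
have e0 : 0 <= A * (n%:R + 1) + K - c n.+1.
  by have := cle n.+1; rewrite -natr1; lra.
have an0 : 0 <= a ^+ n by exact: exprn_ge0.
have h3 : 0 <= (1 - a) * (1 - a) * (a ^+ n * (A * (n%:R + 1) + K - c n.+1)).
  by rewrite !mulr_ge0// subr_ge0 ltW.
set X := a ^+ n in IH an0 h3 *; set N := n%:R in IH h3 *.
rewrite -subr_ge0; rewrite -subr_ge0 in IH.
apply: le_trans (addr_ge0 IH h3) _.
rewrite le_eqVlt; apply/orP; left; apply/eqP; ring.
Qed.

(** Eventually the ratio stays below [A]; the earlier terms are bounded by monotonicity, which
    supplies the additive constant. *)
Lemma limn_esup_lt_linear (c : nat -> R) L A :
  {homo c : m n / (m <= n)%N >-> m <= n} -> (forall n, 0 <= c n) ->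
  limn_esup (fun n => (c n / n%:R)%:E) = L%:E -> L < A ->
  exists K, forall n, c n <= A * n%:R + K.
Proof.
move=> cm c0 limL LA.
have : (limn_esup (fun n => (c n / n%:R)%:E) < A%:E)%E by rewrite limL lte_fin.
move=> /ereal_inf_lt[_ [V [N _ NV] <-]] supA.
have A0 : 0 <= A.
  rewrite -lee_fin; apply: le_trans (ltW supA).
  apply: le_trans (ereal_sup_ubound _) => /=; last first.
    by exists N => //; apply: NV => /=.
  by rewrite lee_fin divr_ge0.
exists (c N.+1) => n; have [nN|Nn] := leqP n N.+1.
  by apply: le_trans (cm _ _ nN) _; rewrite lerDr mulr_ge0.
have n0 : 0 < n%:R :> R by rewrite ltr0n (leq_trans _ Nn).
apply: le_trans (_ : A * n%:R <= _); last by rewrite lerDl.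
rewrite -ler_pdivrMr// -lee_fin; apply: le_trans (ltW supA).
by apply: ereal_sup_ubound; exists n => //; apply: NV => /=; rewrite ltnW// ltnW.
Qed.

Lemma linear_limn_esup_le (c : nat -> R) L K :
  (forall n, c n <= n%:R * L + K) ->
  (limn_esup (fun n => (c n / n%:R)%:E) <= L%:E)%E.
Proof.
move=> cle; apply/lee_addgt0Pr => e e0.
have [N Ne] : exists N : nat, `|K| / e < N%:R.
  exists (Num.bound (`|K| / e)); apply: le_lt_trans (archi_boundP _) => //.
  by rewrite divr_ge0// ltW.
apply: ge_ereal_inf; exists (ereal_sup ((fun n => (c n / n%:R)%:E) @` [set n | (N.+1 <= n)%N])).
  by exists [set n | (N.+1 <= n)%N] => //; exists N.+1.
apply: ge_ereal_sup => _ [n /= Nn <-]; rewrite -EFinD lee_fin.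
have n0 : 0 < n%:R :> R by rewrite ltr0n (leq_trans _ Nn).
rewrite ler_pdivrMr//; apply: le_trans (cle n) _.
rewrite mulrDl (mulrC L) lerD2l.
apply: le_trans (ler_norm K) _; rewrite mulrC -ler_pdivrMr//.
by apply: le_trans (ltW Ne) _; rewrite ler_nat ltnW.
Qed.

End RealSequences.

(** * Induction along the paths of the irreducible source *)

Section Reachability.
Variables (R : realType) (M : nat) (Q : 'M[R]_M).
Hypotheses (Q_ge0 : forall i j, 0 <= Q i j) (Qirr : irreducible Q).

(** A positive entry of a power of [Q] has a positive first step, so induction on the exponent
    follows a path. *)
Lemma reach_ind (P : 'I_M -> Prop) i : P i ->
  (forall k l, P k -> 0 < Q k l -> P l) -> forall j, P j.
Proof.
move=> Pi PQ j; have [n] := Qirr i j.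
elim: n i Pi => [|n IH] i Pi /=.
  by rewrite mxE; case: eqVneq => [<-//|_]; rewrite ltxx.
rewrite mxE => sum_gt0.
have [k /andP[Qik Xkj]|no] := pickP (fun k => (0 < Q i k) && (0 < iter n (mulmx Q) 1%:M k j)).
  by apply: IH Xkj; exact: PQ Qik.
suff : \sum_k Q i k * iter n (mulmx Q) 1%:M k j <= 0 by rewrite leNgt sum_gt0.
apply: sumr_le0 => k _; have := no k; have := Q_ge0 i k.
rewrite le_eqVlt => /predU1P[<-|->/=]; first by rewrite mul0r.
by move=> /negbT; rewrite -leNgt; exact: mulr_ge0_le0.
Qed.

(** Forward induction is applied to the predicate [P k -> P i]. *)
Lemma reach_ind_back (P : 'I_M -> Prop) j : P j ->
  (forall k l, P l -> 0 < Q k l -> P k) -> forall i, P i.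
Proof.
move=> Pj PQ i; have := @reach_ind (fun k => P k -> P i) i id _ j.
by apply => // k l ki Qkl /PQ - /(_ _ Qkl).
Qed.

End Reachability.

(** * Truncated expected costs of a sojourn in one error *)

Section Sojourn.
Variables (R : realType) (c : nat -> R).
Implicit Types q a : R.

(* Expected cost of at most n stages of a sojourn that continues with
   probability q and costs c d at age d. *)
Fixpoint sojourn q n d : R := if n is n'.+1 then c d + q * sojourn q n' d.+1 else 0.

Hypothesis c_ge0 : forall d, 0 <= c d.

Lemma sojourn_ge0 q n d : 0 <= q -> 0 <= sojourn q n d.
Proof. by move=> q0; elim: n d => //= n IH d; rewrite addr_ge0 ?mulr_ge0. Qed.

Lemma sojourn_homo q d : 0 <= q -> {homo (fun n => sojourn q n d) : m n / (m <= n)%N >-> m <= n}.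
Proof.
move=> q0; apply: homo_leq => // [y x z|n]; first exact: le_trans.
elim: n d => [|n IH] d; first exact: sojourn_ge0.
by rewrite /= lerD2l ler_wpM2l// IH.
Qed.

(** The recursion peels off the first stage; peeling off the last one shows that scaling [q] by [a]
    discounts the increments by [a ^+ n]. *)
Lemma sojournSr q n d : sojourn q n.+1 d = sojourn q n d + q ^+ n * c (d + n)%N.
Proof.
elim: n d => [|n IH] d; first by rewrite /= mulr0 expr0 mul1r addn0 addrC.
rewrite [LHS]/= -/(sojourn q n.+1 d.+1) IH addSnnS exprS /=; ring.
Qed.

(** For [q > 0] sojourns from consecutive ages differ by one term and a factor [q], so boundedness
    passes both ways; for [q = 0] only the first stage counts. *)
Lemma sojourn_bounded_age q d d' : 0 <= q ->
  (exists K, forall n, sojourn q n d <= K) -> exists K, forall n, sojourn q n d' <= K.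
Proof.
move=> q0; have [q00|qN0] := eqVneq q 0.
  move=> _; exists (c d') => -[|n] /=; first exact: c_ge0.
  by rewrite q00 mul0r addr0.
have qgt0 : 0 < q by rewrite lt_def qN0.
have up e : (exists K, forall n, sojourn q n e <= K) -> exists K, forall n, sojourn q n e.+1 <= K.
  move=> [K HK]; exists (K / q) => n; rewrite ler_pdivlMr// mulrC.
  by apply: le_trans (HK n.+1); rewrite /= lerDr.
have down e : (exists K, forall n, sojourn q n e.+1 <= K) -> exists K, forall n, sojourn q n e <= K.
  move=> [K HK]; exists (c e + q * K) => n; apply: le_trans (sojourn_homo _ q0 (leqnSn n)) _.
  by rewrite /= lerD2l ler_wpM2l.
move=> bd; have b0 : exists K, forall n, sojourn q n 0 <= K.
  by elim: d bd => // d IH /down.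
by elim: d' => // d' /up.
Qed.

(** The thinned sojourn is a discounted sum of increments, so [abel_bound] turns linear growth into
    boundedness. *)
Lemma sojourn_thin a q d A K : 0 <= a -> a < 1 -> 0 <= q -> 0 <= A ->
  (forall n, sojourn q n d <= A * n%:R + K) ->
  exists K', forall n, sojourn (a * q) n d <= K'.
Proof.
move=> a0 a1 q0 A0 le_A; exists ((A + (1 - a) * K) / (1 - a)) => n.
rewrite ler_pdivlMr ?subr_gt0// mulrC.
apply: (@abel_bound _ (fun n => sojourn (a * q) n d) (fun n => sojourn q n d)) => // m.
by rewrite !sojournSr exprMn; ring.
Qed.

End Sojourn.

(** * The transition operator *)

Section Transitions.
Variables (R : realType) (M : nat) (Q : 'M[R]_M) (ps : R).
Hypotheses (Qstoch : stochastic Q) (ps01 : 0 <= ps <= 1).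
Implicit Types (s : state M) (a : bool) (f : state M -> R).

Let Q_ge0 i j : 0 <= Q i j. Proof. by case: Qstoch. Qed.
Let Q_sum1 i : \sum_(j < M) Q i j = 1. Proof. by case: Qstoch. Qed.
Let ps_ge0 : 0 <= ps. Proof. by case/andP: ps01. Qed.
Let pf_ge0 : 0 <= 1 - ps. Proof. by rewrite subr_ge0; case/andP: ps01. Qed.

Lemma valid_sync e : valid_state Q (e, e, 0%N).
Proof. by left. Qed.

Lemma valid_error1 i j : i != j -> valid_state Q (i, j, 1%N).
Proof. by move=> /eqP ij; right. Qed.

Lemma valid_error i j n : i != j -> 0 < Q i i -> (0 < n)%N -> valid_state Q (i, j, n).
Proof. by move=> /eqP ij Qii n0; right; split=> //; split => // /(_ Qii). Qed.

(** Positive probability matters only when the source stays in an error: it then puts the source in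
    [in_Xap], where every positive age is valid. *)
Lemma valid_step s k e : 0 < Q (sX s) k -> valid_state Q (step s k e).
Proof.
move=> Qk; rewrite /step; case: eqVneq => [->|ke]; first exact: valid_sync.
case: ifPn => [/andP[/eqP kE _]|_]; last exact: valid_error1.
by apply: valid_error => //; rewrite {1}kE.
Qed.

Lemma ler_EP s a f f' :
  (forall s', valid_state Q s' -> f s' <= f' s') -> EP Q ps s a f <= EP Q ps s a f'.
Proof.
move=> ff'; apply: ler_sum => k _.
have := Q_ge0 (sX s) k; rewrite le_eqVlt => /predU1P[<-|Qk]; first by rewrite !mul0r.
apply: ler_wpM2l => //; case: a; last exact/ff'/valid_step.
by apply: lerD; apply: ler_wpM2l => //; exact/ff'/valid_step.
Qed.

Lemma EPD s a f f' : EP Q ps s a (fun s' => f s' + f' s') = EP Q ps s a f + EP Q ps s a f'.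
Proof. by rewrite -big_split; apply: eq_bigr => k _; case: a => /=; ring. Qed.

Lemma EPZ s a x f : EP Q ps s a (fun s' => x * f s') = x * EP Q ps s a f.
Proof. by rewrite mulr_sumr; apply: eq_bigr => k _; case: a => /=; ring. Qed.

Lemma EPB s a f f' : EP Q ps s a (fun s' => f s' - f' s') = EP Q ps s a f - EP Q ps s a f'.
Proof. by rewrite -sumrB; apply: eq_bigr => k _; case: a => /=; ring. Qed.

(** The hypothesis covers two cases at once: [ps = 0], where the estimate never moves, and constant
    [p]. *)
Lemma EP_estimate s a (p : 'I_M -> R) : (forall e e', ps * p e = ps * p e') ->
  EP Q ps s a (fun s' => p (sXh s')) = p (sXh s).
Proof.
move=> psp; rewrite -[RHS]mul1r -(Q_sum1 (sX s)) mulr_suml; apply: eq_bigr => k _.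
case: a => //=; rewrite /sXh /step /= (psp _ (sXh s)) /sXh; ring.
Qed.

Lemma EP_cst s a x : EP Q ps s a (fun=> x) = x.
Proof. exact: (@EP_estimate s a (fun=> x)). Qed.

Lemma EP_ge0 s a f : (forall s', valid_state Q s' -> 0 <= f s') -> 0 <= EP Q ps s a f.
Proof. by move=> f0; rewrite -(EP_cst s a 0); exact: ler_EP. Qed.

Lemma EP_sync s a f : sX s = sXh s -> EP Q ps s a f = EP Q ps s false f.
Proof. by move=> sE; case: a => //; apply: eq_bigr => k _; rewrite sE; ring. Qed.

Lemma EP_succ s f k : (forall s', valid_state Q s' -> 0 <= f s') ->
  Q (sX s) k * f (step s k (sXh s)) <= EP Q ps s false f.
Proof.
move=> f0; rewrite /EP (bigD1 k)//= lerDl; apply: sumr_ge0 => l _.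
have := Q_ge0 (sX s) l; rewrite le_eqVlt => /predU1P[<-|Ql]; first by rewrite mul0r.
by rewrite mulr_ge0//; exact/f0/valid_step.
Qed.

Lemma EP_succ_transmit s f k : (forall s', valid_state Q s' -> 0 <= f s') ->
  Q (sX s) k * ps * f (step s k (sX s)) <= EP Q ps s true f.
Proof.
move=> f0; rewrite /EP (bigD1 k)//= mulrDr -mulrA -addrA lerDl addr_ge0//.
  have := Q_ge0 (sX s) k; rewrite le_eqVlt => /predU1P[<-|Ql]; first by rewrite mul0r.
  by rewrite !mulr_ge0//; exact/f0/valid_step.
apply: sumr_ge0 => l _.
have := Q_ge0 (sX s) l; rewrite le_eqVlt => /predU1P[<-|Ql]; first by rewrite mul0r.
by rewrite mulr_ge0// addr_ge0//; rewrite mulr_ge0//; exact/f0/valid_step.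
Qed.

Lemma cvg_EP T (F : set_system T) {FF : Filter F} (h : T -> state M -> R) f s a :
  (forall s', valid_state Q s' -> h t s' @[t --> F] --> f s') ->
  EP Q ps s a (h t) @[t --> F] --> EP Q ps s a f.
Proof.
move=> hf; apply: cvg_sumr => k.
have := Q_ge0 (sX s) k; rewrite le_eqVlt => /predU1P[<-|Qk].
  by under eq_fun do rewrite mul0r; rewrite mul0r; exact: cvg_cst.
apply: cvgMr; case: a; last exact/hf/valid_step.
by apply: cvgD; apply: cvgMr; exact/hf/valid_step.
Qed.

(* With ps > 0 all estimates communicate by always transmitting; iterating
   d <= C + P d along a path to (r, r) gives d <= C' + (1 - eps) max d. *)
Lemma transmit_max_principle (r : 'I_M) (C : 'I_M -> 'I_M -> R) :
  irreducible Q -> 0 < Q r r -> 0 < ps ->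
  exists K, forall d : 'I_M -> 'I_M -> R, d r r = 0 ->
    (forall i j, d i j <= C i j + \sum_k Q i k * (ps * d k i + (1 - ps) * d k j)) ->
    forall i j, d i j <= K.
Proof.
move=> Qirr Qrr ps0.
pose sys (d : 'I_M -> 'I_M -> R) := d r r = 0 /\
  (forall i j, d i j <= C i j + \sum_k Q i k * (ps * d k i + (1 - ps) * d k j)).
(* [eC] holds the probability of one path to [(r, r)] and a bound on the weighted cost along it,
   uniformly in [d] and [m]. *)
pose near_r i j := exists eC : R * R, 0 < eC.1 /\
  forall d m, sys d -> (forall i j, d i j <= m) -> d i j <= eC.2 + (1 - eC.1) * m.
have near_step i k j : near_r k i -> 0 < Q i k -> near_r i j.
  move=> [[e c] /= [e0 H]] Qik; exists (Q i k * ps * e, C i j + Q i k * ps * c) => /=.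
  split; first by rewrite !mulr_gt0.
  move=> d m sd dm; apply: le_trans (sd.2 i j) _; rewrite -addrA lerD2l.
  rewrite (bigD1 k)//=.
  have h1 : \sum_(l < M | l != k) Q i l * (ps * d l i + (1 - ps) * d l j)
            <= \sum_(l < M | l != k) Q i l * m.
    apply: ler_sum => l _; apply: ler_wpM2l => //.
    have -> : m = ps * m + (1 - ps) * m by ring.
    by apply: lerD; apply: ler_wpM2l.
  have h2 : \sum_(l < M | l != k) Q i l = 1 - Q i k.
    by rewrite -(Q_sum1 i) [in RHS](bigD1 k)//=; ring.
  rewrite -mulr_suml h2 in h1.
  have h3 : Q i k * (ps * d k i) <= Q i k * (ps * (c + (1 - e) * m)).
    by do 2!apply: ler_wpM2l => //; exact: H.
  have h4 : Q i k * ((1 - ps) * d k j) <= Q i k * ((1 - ps) * m).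
    by do 2!apply: ler_wpM2l => //.
  lra.
have near_rr : near_r r r.
  by exists (1, 0); split => //= d m [-> _] _; rewrite subrr mul0r addr0.
have near_all i j : near_r i j.
  (* The self-loop at [r] gives every pair [(r, j)]. Success in [(k, j)] sets the estimate to [k],
     so the claim passes from [l] back to [k] for all estimates. *)
  move: i j; apply: (reach_ind_back Q_ge0 Qirr (j := r)) => [j|k l nl Qkl j].
    exact: near_step near_rr Qrr.
  exact: near_step (nl k) Qkl.
(* At a maximiser of [d] the contraction reads [m <= c + (1 - e) * m]. The maximiser varies with
   [d], hence the sum over all pairs below. *)
have /choice[K HK] : forall x : 'I_M * 'I_M, exists K, forall d, sys d ->
    (forall i j, d i j <= d x.1 x.2) -> d x.1 x.2 <= K.
  move=> [i j]; have [[e c] /= [e0 H]] := near_all i j.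
  exists (c / e) => d sd dm; have := H d _ sd dm; rewrite /= ler_pdivlMr//; lra.
exists (\sum_x `|K x|) => d drr dsys i j.
have [x _ xmax] := @Order.TotalTheory.arg_maxP _ _ _ (r, r) xpredT (fun x => d x.1 x.2) isT.
apply: le_trans (xmax (i, j) isT) _ => /=.
apply: le_trans (HK x d _ _) _ => //; first by move=> i' j'; exact: (xmax (i', j')).
apply: le_trans (ler_norm _) _; rewrite (bigD1 x)//= lerDl.
by apply: sumr_ge0.
Qed.

End Transitions.

(** * Discounted values *)

Section Discounted.
Variables (R : realType) (M : nat) (Q : 'M[R]_M) (ps : R).
Variables (D : 'I_M -> 'I_M -> R) (g : 'I_M -> 'I_M -> nat -> R) (lam : R).
Hypotheses (Qstoch : stochastic Q) (ps01 : 0 <= ps <= 1).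
Hypotheses (D_gt0 : forall i j, i != j -> 0 < D i j).
Hypotheses (g_ge0 : forall i j n, 0 <= g i j n).
Hypotheses (g_homo : forall i j m n, (m <= n)%N -> g i j m <= g i j n).
Hypotheses (lam_ge0 : 0 <= lam).
Implicit Types (s : state M) (f : state M -> R) (sigma : state M -> bool) (a L : R).

Let Q_ge0 i j : 0 <= Q i j. Proof. by case: Qstoch. Qed.

Lemma cost_ge0 s : 0 <= cost D g s.
Proof. by rewrite /cost; case: eqVneq => // ij; rewrite mulr_ge0// ltW// D_gt0. Qed.

Lemma stage_cost_ge0 s b : 0 <= stage_cost D g lam s b.
Proof. by rewrite addr_ge0 ?cost_ge0// mulr_ge0. Qed.

Lemma cost_homo i j m n : (m <= n)%N -> cost D g (i, j, m) <= cost D g (i, j, n).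
Proof.
move=> mn; rewrite /cost /sX /sXh /=; case: eqVneq => // ij.
by apply: ler_wpM2l; [exact/ltW/D_gt0|exact: g_homo].
Qed.

Lemma exp_cost_stationary sigma n hs s :
  exp_cost Q ps D g lam (stationary R sigma) n hs s =
  exp_cost Q ps D g lam (stationary R sigma) n [::] s.
Proof.
elim: n hs s => //= n IH hs s.
have E hs' : exp_cost Q ps D g lam (stationary R sigma) n hs' =
             exp_cost Q ps D g lam (stationary R sigma) n [::].
  by apply/funext => s'; exact: IH.
by rewrite (E (rcons _ (s, false))) (E (rcons _ (s, true))) (E [:: (s, false)])
  (E [:: (s, true)]).
Qed.

Notation C sigma n s := (exp_cost Q ps D g lam (stationary R sigma) n [::] s).

Lemma exp_costS sigma n s : C sigma n.+1 s =
  stage_cost D g lam s (sigma s) + EP Q ps s (sigma s) (fun s' => C sigma n s').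
Proof.
have E b : exp_cost Q ps D g lam (stationary R sigma) n (rcons [::] (s, b)) =
             exp_cost Q ps D g lam (stationary R sigma) n [::].
  by apply/funext => s'; exact: exp_cost_stationary.
rewrite [LHS]/= (E true) (E false) /stationary.
by case: (sigma s); rewrite /= ?subrr ?subr0 ?mul0r ?mul1r ?addr0 ?add0r.
Qed.

Lemma exp_cost_ge0 sigma n s : 0 <= C sigma n s.
Proof.
elim: n s => // n IH s; rewrite exp_costS addr_ge0 ?stage_cost_ge0//.
by apply: EP_ge0 => // s' _; exact: IH.
Qed.

Lemma exp_cost_homo sigma s : {homo (fun n => C sigma n s) : m n / (m <= n)%N >-> m <= n}.
Proof.
apply: homo_leq => // [y x z|n]; first exact: le_trans.
elim: n s => [|n IH] s; first exact: exp_cost_ge0.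
by rewrite exp_costS [leRHS]exp_costS lerD2l; apply: ler_EP => // s' _; exact: IH.
Qed.

Definition discounted_op a f s : R :=
  Num.min (stage_cost D g lam s false + a * EP Q ps s false f)
          (stage_cost D g lam s true + a * EP Q ps s true f).

Definition discounted_iter a n : state M -> R := iter n (discounted_op a) (fun=> 0).

(** The limit is meaningful at valid states for [0 <= a < 1], once a policy of linearly growing cost
    bounds the increasing iterates. *)
Definition discounted_value a s : R := limn (fun n => discounted_iter a n s).

Lemma discounted_op_le a f s b :
  discounted_op a f s <= stage_cost D g lam s b + a * EP Q ps s b f.
Proof. by rewrite /discounted_op ge_min; case: b; rewrite lexx ?orbT. Qed.

Lemma le_discounted_op a f s x :
  (forall b, x <= stage_cost D g lam s b + a * EP Q ps s b f) -> x <= discounted_op a f s.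
Proof. by move=> xle; rewrite le_min !xle. Qed.

Lemma ler_discounted_op a f f' s : 0 <= a -> (forall s', f s' <= f' s') ->
  discounted_op a f s <= discounted_op a f' s.
Proof.
move=> a0 ff'; apply: le_discounted_op => b.
apply: le_trans (discounted_op_le _ _ _ b) _; rewrite lerD2l ler_wpM2l//.
by apply: ler_EP => // s' _; exact: ff'.
Qed.

Lemma discounted_iter_ge0 a n s : 0 <= a -> 0 <= discounted_iter a n s.
Proof.
move=> a0; elim: n s => // n IH s.
apply: le_discounted_op => b; rewrite addr_ge0 ?stage_cost_ge0 ?mulr_ge0//.
by apply: EP_ge0 => // s' _; exact: IH.
Qed.

Lemma discounted_iter_homo a s : 0 <= a ->
  {homo (fun n => discounted_iter a n s) : m n / (m <= n)%N >-> m <= n}.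
Proof.
move=> a0; apply: homo_leq => // [y x z|n]; first exact: le_trans.
elim: n s => [|n IH] s; first exact: discounted_iter_ge0.
by apply: ler_discounted_op => // s'; exact: IH.
Qed.

(** The zero start is trivially monotone in the age; costs are nondecreasing and each move preserves
    the order of ages. *)
Lemma discounted_iter_age a n i j d d' : 0 <= a -> (d <= d')%N ->
  discounted_iter a n (i, j, d) <= discounted_iter a n (i, j, d').
Proof.
move=> a0; elim: n i j d d' => // n IH i j d d' dd'.
have EPage b : EP Q ps (i, j, d) b (discounted_iter a n) <=
               EP Q ps (i, j, d') b (discounted_iter a n).
  have step_age k e : discounted_iter a n (step (i, j, d) k e) <=
                      discounted_iter a n (step (i, j, d') k e).
    rewrite /step /sX /sXh /sD /=; case: (k == e) => //; case: ifP => // _.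
    by apply: IH; rewrite ltnS.
  have ps0 : 0 <= ps by case/andP: ps01.
  have pf0 : 0 <= 1 - ps by rewrite subr_ge0; case/andP: ps01.
  apply: ler_sum => k _; apply: ler_wpM2l => //.
  by case: b; [apply: lerD; apply: ler_wpM2l|]; rewrite ?step_age.
apply: le_discounted_op => b; apply: le_trans (discounted_op_le _ _ _ b) _.
by apply: lerD; rewrite ?ler_wpM2l// /stage_cost lerD2r; exact: cost_homo.
Qed.

Definition discounted_policy_iter sigma a n : state M -> R :=
  iter n (fun f s => stage_cost D g lam s (sigma s) + a * EP Q ps s (sigma s) f)
       (fun=> 0).

Lemma discounted_iter_le_policy sigma a n s : 0 <= a ->
  discounted_iter a n s <= discounted_policy_iter sigma a n s.
Proof.
move=> a0; elim: n s => // n IH s /=.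
apply: le_trans (discounted_op_le _ _ _ (sigma s)) _.
by rewrite lerD2l ler_wpM2l//; apply: ler_EP => // s' _; exact: IH.
Qed.

(** The expected cost of a stage is an increment of the undiscounted cost; this is the recursion of
    [abel_bound]. *)
Lemma discounted_policy_iterS sigma a n s :
  discounted_policy_iter sigma a n.+1 s = discounted_policy_iter sigma a n s
    + a ^+ n * (C sigma n.+1 s - C sigma n s).
Proof.
have wS m t : discounted_policy_iter sigma a m.+1 t = stage_cost D g lam t (sigma t) +
    a * EP Q ps t (sigma t) (discounted_policy_iter sigma a m) by [].
elim: n s => [|n IH] s.
  by rewrite wS exp_costS /= subr0 expr0 mul1r add0r !EP_cst// mulr0.
rewrite wS (wS n) exp_costS (exp_costS sigma n).
rewrite (funext IH).
rewrite EPD EPZ EPB exprS; ring.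
Qed.

(** * Bounds on discounted values, uniform in the discount factor *)

Section BoundedGrowth.
Variables (sigma : state M -> bool) (L : R).
Hypotheses (L_ge0 : 0 <= L) (sigma_growth : forall s A, valid_state Q s -> L < A ->
  exists K, forall n, C sigma n s <= A * n%:R + K).

(** The discounted cost of [sigma] dominates the iterates, and Abel summation bounds it with [K]
    independent of [a] and [n]. *)
Lemma discounted_iter_growth s A : valid_state Q s -> L < A ->
  exists K, forall a n, 0 <= a -> a < 1 -> (1 - a) * discounted_iter a n s <= A + (1 - a) * K.
Proof.
move=> vs LA; have [K CK] := sigma_growth vs LA; exists K => a n a0 a1.
apply: (@le_trans _ _ ((1 - a) * discounted_policy_iter sigma a n s)).
  by apply: ler_wpM2l; [rewrite subr_ge0 ltW|exact: discounted_iter_le_policy].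
apply: (@abel_bound _ (fun n => discounted_policy_iter sigma a n s) (fun n => C sigma n s)) => //.
  by move=> m; exact: discounted_policy_iterS.
by apply: le_trans (ltW LA).
Qed.

Lemma cvg_discounted_value a s : 0 <= a -> a < 1 -> valid_state Q s ->
  discounted_iter a n s @[n --> \oo] --> discounted_value a s.
Proof.
move=> a0 a1 vs; apply: nondecreasing_is_cvgn; first exact: discounted_iter_homo.
have [|K HK] := discounted_iter_growth vs (_ : L < L + 1); first by rewrite ltrDl.
exists ((L + 1 + (1 - a) * K) / (1 - a)) => _ [n _ <-].
by rewrite ler_pdivlMr ?subr_gt0// mulrC HK.
Qed.

Lemma discounted_iter_le_value a n s : 0 <= a -> a < 1 -> valid_state Q s ->
  discounted_iter a n s <= discounted_value a s.
Proof.
move=> a0 a1 vs; apply: nondecreasing_cvgn_le; first exact: discounted_iter_homo.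
by apply/cvg_ex; exists (discounted_value a s); exact: cvg_discounted_value.
Qed.

Lemma discounted_value_le a s x : 0 <= a -> a < 1 -> valid_state Q s ->
  (forall n, discounted_iter a n s <= x) -> discounted_value a s <= x.
Proof.
move=> a0 a1 vs le_x; apply: cvgr_to_le (cvg_discounted_value a0 a1 vs) _.
by apply: nearW.
Qed.

Lemma discounted_value_ge0 a s : 0 <= a -> a < 1 -> valid_state Q s ->
  0 <= discounted_value a s.
Proof. by move=> a0 a1 vs; exact: (@discounted_iter_le_value a 0). Qed.

Lemma discounted_value_growth s A : valid_state Q s -> L < A ->
  exists K, forall a, 0 <= a -> a < 1 -> (1 - a) * discounted_value a s <= A + (1 - a) * K.
Proof.
move=> vs LA; have [K HK] := discounted_iter_growth vs LA; exists K => a a0 a1.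
rewrite mulrC -ler_pdivlMr ?subr_gt0//; apply: discounted_value_le => // n.
by rewrite ler_pdivlMr ?subr_gt0// mulrC HK.
Qed.

Lemma discounted_value_age a i j d d' : 0 <= a -> a < 1 ->
  valid_state Q (i, j, d) -> valid_state Q (i, j, d') -> (d <= d')%N ->
  discounted_value a (i, j, d) <= discounted_value a (i, j, d').
Proof.
move=> a0 a1 vd vd' dd'; apply: discounted_value_le => // n.
by apply: le_trans (discounted_iter_le_value n a0 a1 vd'); exact: discounted_iter_age.
Qed.

Lemma discounted_value_fix a s : 0 <= a -> a < 1 -> valid_state Q s ->
  discounted_value a s = discounted_op a (discounted_value a) s.
Proof.
move=> a0 a1 vs.
have cvS : discounted_iter a n.+1 s @[n --> \oo] --> discounted_op a (discounted_value a) s.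
  apply: cvg_minr; apply: cvgD; try exact: cvg_cst;
    apply: cvgMr; apply: (@cvg_EP _ _ Q ps Qstoch _ _ _ (discounted_iter a)) => s' vs';
    exact: cvg_discounted_value.
by apply: cvg_lim => //; rewrite -cvg_shiftS.
Qed.

Notation V := discounted_value.

(** The youngest valid state of a pair. There are finitely many, and every source move and every
    successful transmission ends in one. *)
Definition base (i j : 'I_M) : state M := (i, j, nat_of_bool (i != j)).

Lemma valid_base i j : valid_state Q (base i j).
Proof.
by rewrite /base; case: eqVneq => [->|ij]; [exact: valid_sync|exact: valid_error1].
Qed.

Lemma valid_age i j d : valid_state Q (i, j, d) -> ((i != j : nat) <= d)%N.
Proof. by case: eqVneq => //= ij [[/= /eqP]|[_ []]//]; rewrite (negbTE ij). Qed.

Lemma step_move s k e : k != sX s -> step s k e = base k e.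
Proof. by move=> /negbTE kX; rewrite /step /base kX; case: eqP. Qed.

Lemma step_resync s k : step s k (sX s) = base k (sX s).
Proof.
rewrite /step /base; by case: eqVneq.
Qed.

Lemma step_stay (i j : 'I_M) d : i != j -> step (i, j, d) i j = (i, j, d.+1).
Proof. by rewrite /step /sX /sXh /= !eqxx => /negbTE ->. Qed.

(** Success erases the old estimate and the age from the continuation; failure acts like idling. *)
Lemma EP_transmit s f : EP Q ps s true f =
  ps * \sum_k Q (sX s) k * f (base k (sX s)) + (1 - ps) * EP Q ps s false f.
Proof.
rewrite /EP !mulr_sumr -big_split; apply: eq_bigr => k _ /=.
rewrite step_resync; ring.
Qed.

Lemma EP_error i j d f : i != j -> EP Q ps (i, j, d) false f =
  Q i i * f (i, j, d.+1) + \sum_(k | k != i) Q i k * f (base k j).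
Proof.
move=> ij; rewrite /EP (bigD1 i)//= /sX /sXh /= step_stay//; congr (_ + _).
by apply: eq_bigr => k ki; rewrite step_move.
Qed.

Lemma EP_synced i f : EP Q ps (i, i, 0%N) false f = \sum_k Q i k * f (base k i).
Proof. by apply: eq_bigr => k _; rewrite (step_resync (i, i, 0%N)). Qed.

Lemma Q_le1 i j : Q i j <= 1.
Proof.
have [_ /(_ i) <-] := Qstoch; rewrite (bigD1 j)//= lerDl.
exact: sumr_ge0.
Qed.

(** A state with [Q i i = 1] would be absorbing, against irreducibility. *)
Lemma Q_self_lt1 i j : irreducible Q -> i != j -> Q i i < 1.
Proof.
move=> Qirr ij; rewrite lt_neqAle Q_le1 andbT; apply: contra ij => /eqP Qii.
suff : i = j by move=> ->.
apply: (reach_ind Q_ge0 Qirr (P := fun k => i = k) (i := i)) => // k l <- Qil.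
apply/eqP; apply: contraTT Qil => il; rewrite -leNgt.
have [_ /(_ i)] := Qstoch; rewrite (bigD1 i)//= (bigD1 l) 1?eq_sym//= Qii => E.
have rest : 0 <= \sum_(k0 < M | (k0 != i) && (k0 != l)) Q i k0 by exact: sumr_ge0.
lra.
Qed.

(* Either h stays bounded below along the ages, and the Bellman equation
   bounds the sojourn cost; or transmitting is eventually never optimal, the
   cost without transmissions grows linearly, and the factor (1 - ps)^n
   makes the sum converge. *)
Lemma transmit_sojourn_bounded (h : state M -> R) i j d :
  irreducible Q -> 0 < ps -> bellman Q ps D g lam L h -> attains_min Q ps D g lam h sigma ->
  i != j ->
  exists K, forall n, sojourn (fun d => cost D g (i, j, d)) ((1 - ps) * Q i i) n d <= K.
Proof.
move=> Qirr ps0 bell att ij; set c := fun d => cost D g (i, j, d).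
have c0 d' : 0 <= c d' by exact: cost_ge0.
have lam0 := lam_ge0; have /andP[_ ps1] := ps01; have pf0 : 0 <= 1 - ps by lra.
set q := (1 - ps) * Q i i; have q0 : 0 <= q by exact: mulr_ge0.
apply: (@sojourn_bounded_age _ c c0 q 1) => //.
have [Qii0|QiiN0] := eqVneq (Q i i) (0 : R).
  exists (c 1%N) => -[|n] /=; first exact: c0.
  by rewrite /q Qii0 mulr0 mul0r addr0.
have Qii : 0 < Q i i by rewrite lt_def QiiN0 Q_ge0.
have Qii1 := Q_self_lt1 Qirr ij.
have qQ : q <= Q i i by rewrite /q ler_piMl//; lra.
set B := \sum_(k | k != i) Q i k * h (base k j).
set Z := \sum_k Q i k * h (base k i).
have hE n : (0 < n)%N -> valid_state Q (i, j, n) by move=> n0; exact: valid_error.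
have Q0E n : Qfac Q ps D g lam h (i, j, n) false = c n + (B + Q i i * h (i, j, n.+1)).
  by rewrite /Qfac /stage_cost EP_error// mulr0 addr0 [B + _]addrC.
have Q1E n : Qfac Q ps D g lam h (i, j, n) true =
    c n + lam + ps * Z + (1 - ps) * (B + Q i i * h (i, j, n.+1)).
  by rewrite /Qfac /stage_cost EP_transmit EP_error// mulr1 [B + _]addrC addrA.
have [kap kapE] : exists kap : R, kap = `|L| + `|B| + `|Z| by exists (`|L| + `|B| + `|Z|).
have kap0 : 0 <= kap by rewrite kapE !addr_ge0.
(* The first bound on [K] absorbs the constants of one Bellman step in [back]; the second makes
   transmitting strictly worse once [h < - K] at the next age. *)
have [K [K0 Kkap KBZ]] : exists K : R,
    [/\ 0 <= K, kap <= K * (1 - Q i i) & `|B| + `|Z| <= K * Q i i].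
  exists (kap / (1 - Q i i) + (`|B| + `|Z|) / Q i i); split.
  - by rewrite addr_ge0 ?divr_ge0 ?subr_ge0 ?(ltW Qii1) ?(ltW Qii) ?addr_ge0.
  - by rewrite -ler_pdivrMr ?subr_gt0// lerDl divr_ge0 ?addr_ge0// ltW.
  - by rewrite -ler_pdivrMr// lerDr divr_ge0// subr_ge0 ltW.
have nL := ler_norm L; have nB := ler_norm B.
have nB' : - `|B| <= B by rewrite lerNl -normrN ler_norm.
have nZ' : - `|Z| <= Z by rewrite lerNl -normrN ler_norm.

have psC : - `|Z| <= ps * Z.
  rewrite -subr_ge0; have : 0 <= ps * (Z + `|Z|) by rewrite mulr_ge0//; [lra|lra].
  have : 0 <= (1 - ps) * `|Z| by rewrite mulr_ge0.
  lra.
have pfB : - `|B| <= (1 - ps) * B.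
  rewrite -subr_ge0; have : 0 <= (1 - ps) * (B + `|B|) by rewrite mulr_ge0//; lra.
  have : 0 <= ps * `|B| by rewrite mulr_ge0// ltW.
  lra.
(* Backward from an age with [- K <= h]: whichever action attains the minimum, the sojourn continues
   with probability at least [q]. *)
have back n : forall d, (0 < d)%N -> - K <= h (i, j, (d + n)%N) ->
    sojourn c q n d - K <= h (i, j, d).
  elim: n => [|n IH] d' d0; first by rewrite addn0 /= add0r.
  rewrite -addSnnS => /(IH d'.+1 isT) hd'.
  have := bell _ (hE _ d0); rewrite Q0E Q1E /= => bd.
  have S0 : 0 <= sojourn c q n d'.+1 by exact: sojourn_ge0.
  set S := sojourn c q n d'.+1 in hd' S0 *; set H := h (i, j, d'.+1) in hd' bd *.
  have qH : q * (S - K) <= q * H by exact: ler_wpM2l.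
  have QH : Q i i * (S - K) <= Q i i * H by apply: ler_wpM2l hd'.
  have qQS : q * S <= Q i i * S by exact: ler_wpM2r.
  have qQK : q * K <= Q i i * K by exact: ler_wpM2r.
  clearbody S H.
  have qE : q * H = (1 - ps) * (Q i i * H) by rewrite /q mulrA.
  have nZ0 := normr_ge0 Z.
  case: (leP (c d' + (B + Q i i * H))
    (c d' + lam + ps * Z + (1 - ps) * (B + Q i i * H))) bd => _ bd;
    clearbody q B Z c; lra.
have [often|rare] := pselect (forall N, exists2 n, (N <= n)%N & - K <= h (i, j, n.+1)).
  exists (h (i, j, 1%N) + K) => n; have [m nm hm] := often n.
  apply: le_trans (sojourn_homo c0 1 q0 nm) _; rewrite -lerBlDr.
  by apply: back => //; rewrite add1n.
have [N hN] : exists N, forall n, (N <= n)%N -> h (i, j, n.+1) < - K.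
  apply: contrapT => noN; apply: rare => N; apply: contrapT => noN'; apply: noN.
  exists N => n Nn; rewrite ltNge; apply/negP => hn; apply: noN'; by exists n.
have quiet n : (N < n)%N -> sigma (i, j, n) = false.
  move=> Nn; apply/negP => sT; have n0 : (0 < n)%N by exact: leq_ltn_trans Nn.
  have := att _ (hE _ n0); rewrite sT => Emin.
  have : Qfac Q ps D g lam h (i, j, n) true <= Qfac Q ps D g lam h (i, j, n) false.
    by rewrite Emin ge_min lexx.
  rewrite Q0E Q1E; have := hN n (ltnW Nn); set H := h _ => hK.
  have QK : Q i i * H < Q i i * - K by rewrite ltr_pM2l.
  have : 0 < ps * (Z - B - Q i i * H) by rewrite mulr_gt0//; lra.
  lra.
have lower n : forall d, (N < d)%N -> sojourn c (Q i i) n d <= C sigma n (i, j, d).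
  elim: n => [|n IH] d' Nd; first exact: exp_cost_ge0.
  rewrite exp_costS quiet// /= /stage_cost mulr0 addr0 lerD2l.
  apply: le_trans (@EP_succ _ _ _ ps Qstoch (i, j, d') _ i _).
    by rewrite /sX /sXh /= step_stay// ler_wpM2l// IH// ltnW.
  by move=> s' _; exact: exp_cost_ge0.
have [A LA] : exists A, L < A by exists (L + 1); lra.
have [A' hA'] := sigma_growth (hE N.+1 isT) LA.
apply: (@sojourn_bounded_age _ c c0 q N.+1) => //.
apply: (@sojourn_thin _ c (1 - ps) (Q i i) N.+1 A A') => //.
- by rewrite ltrBlDr ltrDl.
- exact: le_trans L_ge0 (ltW LA).
- by move=> n; apply: le_trans (hA' n); exact: lower.
Qed.

Lemma discounted_value_le_stage a s b : 0 <= a -> a < 1 -> valid_state Q s ->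
  V a s <= stage_cost D g lam s b + EP Q ps s b (V a).
Proof.
move=> a0 a1 vs; rewrite {1}discounted_value_fix//.
apply: le_trans (discounted_op_le _ _ _ b) _; rewrite lerD2l ler_piMl ?(ltW a1)//.
by apply: EP_ge0 => // s' vs'; exact: discounted_value_ge0.
Qed.

(** * Comparison with a reference state by transmitting, for [0 < ps] *)

Section Transmit.
Variables (h : state M -> R) (r : 'I_M).
Hypotheses (Qirr : irreducible Q) (Qrr : 0 < Q r r) (ps_gt0 : 0 < ps).
Hypotheses (bell : bellman Q ps D g lam L h) (att : attains_min Q ps D g lam h sigma).

(** Expected value one stage after transmitting in the error [(i, j)], without the event that the
    error persists. *)
Let Z a i j := ps * (\sum_k Q i k * V a (base k i)) +
  (1 - ps) * \sum_(k | k != i) Q i k * V a (base k j).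

Let ps_ge0 : 0 <= ps. Proof. exact: ltW. Qed.
Let pf_ge0 : 0 <= 1 - ps. Proof. by rewrite subr_ge0; case/andP: ps01. Qed.

Let fail_lt1 i : (1 - ps) * Q i i < 1.
Proof.
apply: (@le_lt_trans _ _ (1 - ps)); first by rewrite ler_piMr// Q_le1.
by rewrite ltrBlDr ltrDl.
Qed.

(** Transmitting until the error ends is one possible choice: its age costs form a bounded sojourn,
    its fees and exit values a geometric series. *)
Lemma value_le_sojourn i j d : i != j -> valid_state Q (i, j, d) ->
  exists K, forall a, 0 <= a -> a < 1 ->
    (1 - (1 - ps) * Q i i) * V a (i, j, d) <= K + Z a i j.
Proof.
move=> ij vs.
have [K HK] := transmit_sojourn_bounded d Qirr ps_gt0 bell att ij.
set q := (1 - ps) * Q i i in HK *; have q1 : q < 1 by exact: fail_lt1.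
have q0 : 0 <= q by exact: mulr_ge0.
exists ((1 - q) * K + lam) => a a0 a1; rewrite mulrC -ler_pdivlMr ?subr_gt0//.
apply: discounted_value_le => // n.
apply: (@le_trans _ _ (sojourn (fun d => cost D g (i, j, d)) q n d + (lam + Z a i j) / (1 - q))).
  have Z0 : 0 <= Z a i j.
    by rewrite addr_ge0// mulr_ge0// sumr_ge0// => k _; rewrite mulr_ge0//;
       apply: discounted_value_ge0 => //; exact: valid_base.
  elim: n d {HK vs} => [|n IH] d.
    by rewrite /= add0r; apply: divr_ge0; [exact: addr_ge0|rewrite subr_ge0 ltW].
  apply: le_trans (discounted_op_le _ _ _ true) _.
  apply: (@le_trans _ _ (cost D g (i, j, d) + lam +
    (q * discounted_iter a n (i, j, d.+1) + Z a i j))).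
    rewrite /stage_cost mulr1 lerD2l.
    apply: le_trans (_ : EP Q ps (i, j, d) true (discounted_iter a n) <= _).
      by rewrite ler_piMl ?(ltW a1)//; apply: EP_ge0 => // s' _; exact: discounted_iter_ge0.
    rewrite EP_transmit EP_error// mulrDr addrCA /q -mulrA lerD2l.
    apply: lerD; apply: ler_wpM2l => //; apply: ler_sum => k _; apply: ler_wpM2l => //;
      apply: discounted_iter_le_value => //; exact: valid_base.
  have qIH : q * discounted_iter a n (i, j, d.+1) <=
      q * (sojourn (fun d => cost D g (i, j, d)) q n d.+1 + (lam + Z a i j) / (1 - q)).
    exact: ler_wpM2l.
  (* The quotient is the fixed point of [t = lam + Z a i j + q * t], so the bound reproduces
     itself. *)
  have E : (lam + Z a i j) / (1 - q) = lam + Z a i j + q * ((lam + Z a i j) / (1 - q)).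
    by field; rewrite subr_eq0 eq_sym lt_eqF.
  rewrite /= E; move: qIH; rewrite mulrDr; set t := q * (_ / _); set u := q * sojourn _ _ _ _.
  move: (q * _) (cost _ _ _) (Z a i j) => x y z; lra.
have -> : ((1 - q) * K + lam + Z a i j) / (1 - q) = K + (lam + Z a i j) / (1 - q).
  by field; rewrite subr_eq0 eq_sym lt_eqF.
by rewrite lerD2r.
Qed.

Let Z_sum a i j : Z a i j + (1 - ps) * Q i i * V a (base i j) =
  \sum_k Q i k * (ps * V a (base k i) + (1 - ps) * V a (base k j)).
Proof.
rewrite /Z -addrA -(mulrA (1 - ps)) -mulrDr [X in (1 - ps) * X]addrC.
have -> : Q i i * V a (base i j) + \sum_(k < M | k != i) Q i k * V a (base k j) =
          \sum_k Q i k * V a (base k j) by rewrite [RHS](bigD1 i).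
rewrite !mulr_sumr -big_split; apply: eq_bigr => k _ /=; ring.
Qed.

(** The differences [V a (base i j) - V a (base r r)] satisfy the system of [transmit_max_principle]
    with constants free of [a]. *)
Lemma value_base_le : exists K, forall a i j, 0 <= a -> a < 1 ->
  V a (base i j) <= V a (base r r) + K.
Proof.
have /choice[Cf HC] : forall x : 'I_M * 'I_M, exists K, forall a, 0 <= a -> a < 1 ->
    V a (base x.1 x.2) <= K + (Z a x.1 x.2 + (1 - ps) * Q x.1 x.1 * V a (base x.1 x.2)).
  move=> [i j] /=; have [<-{j}|ij] := eqVneq i j.
    exists 0 => a a0 a1; rewrite add0r Z_sum.
    have vi := valid_base i i.
    apply: le_trans (discounted_value_le_stage false a0 a1 vi) _.
    rewrite /base eqxx EP_synced /stage_cost /cost /sX /sXh /= eqxx mulr0 !add0r.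
    by apply: ler_sum => k _; apply: ler_wpM2l => //; rewrite -mulrDl subrKC mul1r.
  have [K HK] := value_le_sojourn ij (valid_base i j : valid_state Q (i, j, _)).
  exists K => a a0 a1; have := HK a a0 a1; rewrite -/(base i j).
  move: (V a _) ((1 - ps) * _) (Z _ _ _) => x y z; lra.
have [K HK] := @transmit_max_principle _ _ _ _ Qstoch ps01 r (fun i j => Cf (i, j)) Qirr Qrr ps_gt0.
exists K => a i j a0 a1; rewrite -lerBlDl.
apply: (HK (fun i j => V a (base i j) - V a (base r r))) => [|{}i {}j]; first exact: subrr.
rewrite lerBlDr; apply: le_trans (HC (i, j) a a0 a1) _; rewrite Z_sum /= -addrA lerD2l.
have [_ /(_ i) Q1] := Qstoch.
have Er : V a (base r r) = \sum_k Q i k * V a (base r r) by rewrite -mulr_suml Q1 mul1r.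
rewrite [X in _ <= _ + X]Er -big_split /= le_eqVlt; apply/orP; left; apply/eqP.
by apply: eq_bigr => k _; ring.
Qed.

(** Older errors reduce to base states, since every exit counted in [Z] is one. *)
Lemma value_le_ref s : valid_state Q s ->
  exists K, forall a, 0 <= a -> a < 1 -> V a s <= V a (base r r) + K.
Proof.
case: s => [[i j] d] vs; have [K HK] := value_base_le.
have [ij|ij] := eqVneq i j.
  exists K => a a0 a1; apply: le_trans (HK a i j a0 a1); rewrite /base ij eqxx.
  case: vs => [[/= _ d0]|[]]; last by rewrite /sX /sXh /= ij.
  by rewrite -d0.
have [K' HK'] := value_le_sojourn ij vs.
set q := (1 - ps) * Q i i in HK'; have q1 : q < 1 by exact: fail_lt1.
exists (K' / (1 - q) + K) => a a0 a1.
rewrite -(ler_pM2l (x := 1 - q)) ?subr_gt0//; apply: le_trans (HK' a a0 a1) _.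
have W k e : V a (base k e) <= V a (base r r) + K by exact: HK.
suff : Z a i j <= (1 - q) * (V a (base r r) + K).
  have E : (1 - q) * (K' / (1 - q)) = K' by rewrite mulrC divfK// subr_eq0 eq_sym lt_eqF.
  rewrite !mulrDr E; move: (V a _) (Z _ _ _) => x z; lra.
have [_ /(_ i) Q1] := Qstoch.
have Qi : \sum_(k | k != i) Q i k = 1 - Q i i
  by have := Q1; rewrite (bigD1 i)//= => <-; rewrite addrAC subrr add0r.
have -> : (1 - q) * (V a (base r r) + K) = ps * (\sum_k Q i k * (V a (base r r) + K))
   + (1 - ps) * \sum_(k | k != i) Q i k * (V a (base r r) + K).
  by rewrite -!mulr_suml Qi Q1 /q; ring.
by apply: lerD; apply: ler_wpM2l => //; apply: ler_sum => k _; exact: ler_wpM2l.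
Qed.

(** The upper bound makes the slack [V a (base r r) + Kb s - V a s] nonnegative. After a state with
    a lower bound its expectation is bounded, hence so is the slack at each successor of positive
    probability. *)
Lemma ref_le_value s : valid_state Q s ->
  exists K, forall a, 0 <= a -> a < 1 -> V a (base r r) <= V a s + K.
Proof.
have /choice[Kb HKb] : forall s, exists K, valid_state Q s ->
    forall a, 0 <= a -> a < 1 -> V a s <= V a (base r r) + K.
  move=> s'; have [vs'|nv] := pselect (valid_state Q s'); last by exists 0.
  by have [K HK] := value_le_ref vs'; exists K.
pose low s := exists K, forall a, 0 <= a -> a < 1 -> V a (base r r) <= V a s + K.
have low_step t t' b p : valid_state Q t -> 0 < p ->
    (forall f, (forall s', valid_state Q s' -> 0 <= f s') -> p * f t' <= EP Q ps t b f) ->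
    low t -> low t'.
  move=> vt p0 succ [K HK].
  exists ((EP Q ps t b Kb + K + stage_cost D g lam t b) / p - Kb t') => a a0 a1.
  have f0 s' : valid_state Q s' -> 0 <= V a (base r r) + Kb s' - V a s'.
    by move=> vs'; rewrite subr_ge0 HKb.
  suff : V a (base r r) + Kb t' - V a t' <=
         (EP Q ps t b Kb + K + stage_cost D g lam t b) / p.
    by move: (V a _) (V a _) (_ / p) (Kb _) => x y z k; lra.
  rewrite ler_pdivlMr// mulrC; apply: le_trans (succ _ f0) _.
  rewrite EPB EPD EP_cst//.
  have := HK a a0 a1; have := discounted_value_le_stage b a0 a1 vt.
  move: (V a _) (V a t) (EP Q ps t b Kb) (EP _ _ _ _ _) => x y u v.
  by move: (stage_cost _ _ _ _ _) => m; lra.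
have low_stay j k l : low (base k j) -> 0 < Q k l -> low (base l j).
  have [->//|lk] := eqVneq l k; move=> lkj Qkl.
  apply: (low_step _ _ false _ (valid_base k j) Qkl _ lkj) => f f0.
  by have := @EP_succ _ _ _ ps Qstoch (base k j) f l f0; rewrite step_move.
have low_all k j : low (base k j).
  have lowr k' : low (base k' r).
    move: k'; apply: (reach_ind Q_ge0 Qirr (i := r)); last by move=> k' l; exact: low_stay.
    by exists 0 => a _ _; rewrite addr0.
  have [l Qjl] : exists l, 0 < Q j l.
    have [l Ql|noQ] := pickP (fun l => 0 < Q j l); first by exists l.
    have [_ /(_ j)] := Qstoch; rewrite big1 => [|l _]; first by move/eqP; rewrite eq_sym oner_eq0.
    by apply/eqP; rewrite eq_le Q_ge0 leNgt noQ.
  apply: (reach_ind Q_ge0 Qirr (P := fun k => low (base k j)) (i := l));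
    last by move=> k' l'; exact: low_stay.
  (* A successful transmission in [(j, r)] sets the estimate to [j] while the source moves to
     [l]. *)
  apply: (low_step _ _ true _ (valid_base j r) (mulr_gt0 Qjl ps_gt0) _ (lowr j)) => f f0.
  by have := @EP_succ_transmit _ _ _ _ Qstoch ps01 (base j r) f l f0; rewrite step_resync.
case: s => [[i j] d] vs; have [K HK] := low_all i j; exists K => a a0 a1.
apply: le_trans (HK a a0 a1) _; rewrite lerD2r.
by apply: discounted_value_age => //; [exact: valid_base|exact: valid_age].
Qed.

End Transmit.

(* When ps = 0 the value is superharmonic for the source chain with the
   estimate frozen, so its excess over the minimum propagates forward along
   the chain from the minimizing state. *)
Lemma passive_value_bounded : irreducible Q -> ps = 0 ->
  exists ref : R -> 'I_M -> R, forall s, valid_state Q s ->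
    exists K, forall a, 2^-1 <= a -> a < 1 -> `|V a s - ref a (sXh s)| <= K.
Proof.
move=> Qirr ps0.
pose x a e := [arg min_(i < e) V a (base i e)]%O.
have xmin a e i : V a (base (x a e) e) <= V a (base i e).
  by rewrite /x; case: Order.TotalTheory.arg_minP => // k _; exact.
pose ref a e := V a (base (x a e) e); exists ref.
have half0 a : 2^-1 <= a -> 0 <= a by apply: le_trans; rewrite invr_ge0.
have age_base a i j d : 2^-1 <= a -> a < 1 -> valid_state Q (i, j, d) ->
    V a (base i j) <= V a (i, j, d).
  move=> a2 a1 vs; apply: discounted_value_age => //.
  - exact: half0.
  - exact: valid_base.
  - exact: valid_age.
have dev_ge0 a s : 2^-1 <= a -> a < 1 -> valid_state Q s -> 0 <= V a s - ref a (sXh s).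
  case: s => [[i j] d] a2 a1 vs; rewrite subr_ge0.
  by apply: le_trans (xmin a j i) _; exact: age_base.
have /choice[B HB] : forall e, exists B, forall a, 2^-1 <= a -> a < 1 -> (1 - a) * ref a e <= B.
  move=> e; have [|K HK] := discounted_value_growth (valid_sync Q e) (_ : L < L + 1).
    by rewrite ltrDl.
  exists (L + 1 + `|K|) => a a2 a1; have a0 := half0 _ a2.
  apply: le_trans (_ : (1 - a) * V a (e, e, 0%N) <= _).
    apply: ler_wpM2l; first by rewrite subr_ge0 ltW.
    have -> : (e, e, 0%N) = base e e by rewrite /base eqxx.
    exact: xmin.
  apply: le_trans (HK a a0 a1) _; rewrite lerD2l.
  apply: le_trans (_ : (1 - a) * `|K| <= _).
    by apply: ler_wpM2l; [rewrite subr_ge0 ltW|exact: ler_norm].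
  by rewrite ler_piMl// lerBlDr lerDl.
(* With [E] the expected next value, [v] the value and [m] the reference,
   [a * (E - m) <= v - m + (1 - a) * m]; the factor 2 bounds [a^-1]. *)
have dev_step s k a : 2^-1 <= a -> a < 1 -> valid_state Q s -> 0 < Q (sX s) k ->
    V a (step s k (sXh s)) - ref a (sXh s) <=
    2 * (V a s - ref a (sXh s) + B (sXh s)) / Q (sX s) k.
  move=> a2 a1 vs Qk; have a0 := half0 _ a2; rewrite ler_pdivlMr// mulrC.
  apply: le_trans (@EP_succ _ _ _ ps Qstoch s (fun s' => V a s' - ref a (sXh s')) k
    (fun s' => dev_ge0 a s' a2 a1)) _.
  rewrite EPB EP_estimate//; last by move=> e e'; rewrite ps0 !mul0r.
  have : a * EP Q ps s false (V a) <= V a s.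
    rewrite [leRHS]discounted_value_fix//; apply: le_discounted_op => b.
    have -> : EP Q ps s false (V a) = EP Q ps s b (V a).
      by case: b => //; rewrite EP_transmit ps0 mul0r add0r subr0 mul1r.
    by rewrite lerDr stage_cost_ge0.
  have := dev_ge0 a s a2 a1 vs; have := HB (sXh s) a a2 a1; have := dev_ge0 a s a2 a1 vs.
  have dEP : 0 <= EP Q ps s false (V a) - ref a (sXh s).
    have -> : EP Q ps s false (V a) - ref a (sXh s) =
              EP Q ps s false (fun s' => V a s' - ref a (sXh s')).
      by rewrite EPB EP_estimate// => e e'; rewrite ps0 !mul0r.
    by apply: EP_ge0 => // s' vs'; exact: dev_ge0.
  move: (EP _ _ _ _ _) (V a s) (ref _ _) (B _) dEP => E v m b dEP d0 bB _ aE.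
  have : 2^-1 * (E - m) <= a * (E - m) by exact: ler_wpM2r.
  lra.
have base_bounded e k : exists K, forall a, 2^-1 <= a -> a < 1 -> V a (base k e) - ref a e <= K.
  (* The minimiser [x a e] varies with [a], so a constant is found for each possible value [y] and
     the constants are then summed. *)
  have /choice[K HK] : forall y, exists K, forall a, 2^-1 <= a -> a < 1 -> x a e = y ->
      V a (base k e) - ref a e <= K.
    move=> y; move: k; apply: (reach_ind Q_ge0 Qirr (i := y)).
      by exists 0 => a _ _ xy; rewrite /ref xy subrr.
    move=> k l [K HK] Qkl; have [->|lk] := eqVneq l k; first by exists K.
    exists (2 * (K + B e) / Q k l) => a a2 a1 xy.
    have := dev_step (base k e) l a a2 a1 (valid_base k e) Qkl; rewrite step_move//.
    move/le_trans; apply; rewrite ler_pM2r ?invr_gt0// ler_pM2l// lerD2r.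
    exact: HK.
  exists (\sum_y `|K y|) => a a2 a1; apply: le_trans (HK (x a e) a a2 a1 erefl) _.
  apply: le_trans (ler_norm _) _; rewrite (bigD1 (x a e))//= lerDl.
  exact: sumr_ge0.
move=> [[i j] d] vs.
suff [K HK] : exists K, forall a, 2^-1 <= a -> a < 1 -> V a (i, j, d) - ref a j <= K.
  by exists K => a a2 a1; rewrite ger0_norm; [exact: HK|exact: dev_ge0].
case: vs => [[/= ij d0]|[/= /eqP ij [d1 dap]]].
  have [K HK] := base_bounded j i; exists K => a a2 a1.
  by have := HK a a2 a1; rewrite /base; move: ij d0; rewrite /sX /sXh /sD /= => -> ->; rewrite eqxx.
have {}ij : i != j := ij.
have {}dap : ~ 0 < Q i i -> d = 1%N := dap.
have {}d1 : (0 < d)%N := d1.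
(* An age above 1 is reached from its predecessor by the self-loop at [i]. *)
elim: d d1 dap => // -[|d] IH _ dap.
  by have [K HK] := base_bounded j i; exists K => a a2 a1; have := HK a a2 a1; rewrite /base ij.
have Qii : 0 < Q i i.
  by apply: contrapT => /dap.
have [//|//|K HK] := IH.
exists (2 * (K + B j) / Q i i) => a a2 a1.
have vd : valid_state Q (i, j, d.+1) by exact: valid_error.
have := dev_step (i, j, d.+1) i a a2 a1 vd Qii; rewrite /sX /sXh /= step_stay//.
move/le_trans; apply; rewrite ler_pM2r ?invr_gt0// ler_pM2l// lerD2r.
exact: HK.
Qed.

(** For [0 < ps] one reference value serves all estimates; for [ps = 0] the estimates do not
    communicate and each needs its own. *)
Lemma value_bounded (h : state M -> R) :
  irreducible Q -> (exists i, in_Xap Q i) ->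
  bellman Q ps D g lam L h -> attains_min Q ps D g lam h sigma ->
  exists ref : R -> 'I_M -> R, (forall a e e', ps * ref a e = ps * ref a e') /\
    forall s, valid_state Q s ->
      exists K, forall a, 2^-1 <= a -> a < 1 -> `|V a s - ref a (sXh s)| <= K.
Proof.
move=> Qirr [r Qrr] bell att; have [ps0|psN0] := eqVneq ps 0.
  have [ref Href] := passive_value_bounded Qirr ps0.
  by exists ref; split => // a e e'; rewrite ps0 !mul0r.
have ps_gt0 : 0 < ps by rewrite lt_def psN0; case/andP: ps01.
exists (fun a _ => V a (base r r)); split => // s vs.
have [K HK] := value_le_ref Qirr Qrr ps_gt0 bell att vs.
have [K' HK'] := ref_le_value Qirr Qrr ps_gt0 bell att vs.
exists (`|K| + `|K'|) => a a2 a1; have a0 : 0 <= a by apply: le_trans a2; rewrite invr_ge0.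
have nK := ler_norm K; have nK' := ler_norm K'.
have pK := normr_ge0 K; have pK' := normr_ge0 K'.
rewrite ler_norml; have := HK a a0 a1; have := HK' a a0 a1.
by move: (V a s) (V a _) => v w h1 h2; apply/andP; split; lra.
Qed.

Lemma vanishing_discount (h : state M -> R) :
  irreducible Q -> (exists i, in_Xap Q i) ->
  bellman Q ps D g lam L h -> attains_min Q ps D g lam h sigma ->
  exists (rho : 'I_M -> R) (f : state M -> R),
    [/\ forall e, rho e <= L, forall e e', ps * rho e = ps * rho e',
        forall s, valid_state Q s -> rho (sXh s) + f s =
          Num.min (Qfac Q ps D g lam f s false) (Qfac Q ps D g lam f s true)
      & forall i j d d', valid_state Q (i, j, d) -> valid_state Q (i, j, d') ->
          (d <= d')%N -> f (i, j, d) <= f (i, j, d')].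
Proof.
move=> Qirr Qap bell att; have [ref [psref Href]] := value_bounded Qirr Qap bell att.
(* Discount factors tending to 1; the shift by 2 keeps them at least [2^-1]. *)
pose al (n : nat) : R := 1 - n.+2%:R^-1.
have al2 n : 2^-1 <= al n.
  rewrite /al lerBrDr -lerBrDl; have -> : 1 - 2^-1 = 2^-1 :> R by lra.
  by rewrite lef_pV2 ?posrE// ler_nat.
have al1 n : al n < 1 by rewrite /al ltrBlDr ltrDl invr_gt0.
have al0 n : 0 <= al n by apply: le_trans (al2 n); rewrite invr_ge0.
have [U [UU ooU]] := ultraFilterLemma (eventually_filter : ProperFilter \oo).
have UP := @ultra_proper _ _ UU.
have al_cvg : al n @[n --> U] --> (1 : R).
  apply: (@cvg_trans _ (al n @[n --> \oo])); first by move=> X; exact: ooU.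
  suff : al n @[n --> \oo] --> (1 - 0 : R) by rewrite subr0.
  apply: cvgB; first exact: cvg_cst.
  by have := @cvg_harmonic R; rewrite -(@cvg_shiftS _ (@harmonic R)).
pose dev n s := V (al n) s - ref (al n) (sXh s).
have /choice[f Hf] : forall s, exists l : R, valid_state Q s -> dev n s @[n --> U] --> l.
  move=> s; have [vs|nv] := pselect (valid_state Q s); last by exists 0.
  have [K HK] := Href s vs.
  by have [l Hl] := @cvg_ultra_bounded _ _ U (dev^~ s) K UU
    (fun n => HK _ (al2 n) (al1 n)); exists l.
(* The value at a synced state has controlled growth, and [ref] differs from it by a bounded
   amount. *)
have ref_growth e A : L < A -> exists K, 0 <= K /\
    forall n, - K <= (1 - al n) * ref (al n) e <= A + (1 - al n) * K.
  move=> LA; have [K HK] := discounted_value_growth (valid_sync Q e) LA.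
  have [K' HK'] := Href _ (valid_sync Q e); exists (`|K| + `|K'|); split; first exact: addr_ge0.
  move=> n; have := HK _ (al0 n) (al1 n); have := HK' _ (al2 n) (al1 n).
  have := discounted_value_ge0 (al0 n) (al1 n) (valid_sync Q e).
  rewrite /sXh /= ler_norml.
  move: (al n) (al0 n) (al1 n) (V _ _) (ref _ _) => a a0 a1 v m v0 /andP[h1 h2] h3.
  have nK := ler_norm K; have nK' := ler_norm K'.
  have pK := normr_ge0 K; have pK' := normr_ge0 K'.
  have b0 : 0 <= 1 - a by lra.
  have t1 : (1 - a) * (v - m) <= (1 - a) * `|K'| by apply: ler_wpM2l => //; lra.
  have t2 : (1 - a) * - `|K'| <= (1 - a) * (v - m) by apply: ler_wpM2l => //; lra.
  have t3 : (1 - a) * K <= (1 - a) * `|K| by apply: ler_wpM2l.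
  have t4 : 0 <= (1 - a) * v by apply: mulr_ge0.
  have t5 : 0 <= a * `|K'| by apply: mulr_ge0.
  by apply/andP; split; lra.
have /choice[rho Hrho] : forall e, exists l : R, (1 - al n) * ref (al n) e @[n --> U] --> l.
  move=> e; have [|K [K0 HK]] := ref_growth e (L + 1); first by rewrite ltrDl.
  apply: (@cvg_ultra_bounded _ _ U _ (L + 1 + K)) => n.
  have := HK n; have := L_ge0; move: ((1 - al n) * ref _ _) => m L0 /andP[h1 h2].
  have t : 0 <= al n * K by exact: mulr_ge0.
  by rewrite ler_norml; apply/andP; split; lra.
exists rho, f; split.
- move=> e; apply/ler_addgt0Pr => eps eps0.
  have [|K [K0 HK]] := ref_growth e (L + eps); first by rewrite ltrDl.
  have -> : L + eps = L + eps + (1 - 1) * K by rewrite subrr mul0r addr0.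
  apply: (@ler_cvg_to _ U _ R _ _ _ _ (Hrho e) (_ : L + eps + (1 - al n) * K @[n --> U] --> _)).
    apply: cvgD; first exact: cvg_cst.
    by apply: cvgMl; apply: cvgB => //; exact: cvg_cst.
  by apply: nearW => n; have /andP[] := HK n.
- move=> e e'.
  have c1 : ps * ((1 - al n) * ref (al n) e) @[n --> U] --> ps * rho e by apply: cvgMr; exact: Hrho.
  have c2 : ps * ((1 - al n) * ref (al n) e') @[n --> U] --> ps * rho e'.
    by apply: cvgMr; exact: Hrho.
  have E : (fun n => ps * ((1 - al n) * ref (al n) e)) =
      (fun n => ps * ((1 - al n) * ref (al n) e')).
    by apply/funext => n; rewrite mulrCA (psref _ e e') mulrCA.
  by rewrite E in c1; exact: (cvg_unique (@Rhausdorff R) c1 c2).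
- move=> s vs.
  have c1 : (1 - al n) * ref (al n) (sXh s) + dev n s @[n --> U] --> rho (sXh s) + f s.
    by apply: cvgD; [exact: Hrho|exact: Hf].
  have EPc b : stage_cost D g lam s b + al n * EP Q ps s b (dev n) @[n --> U] -->
      Qfac Q ps D g lam f s b.
    apply: cvgD; first exact: cvg_cst.
    rewrite -[EP _ _ _ _ f]mul1r; apply: cvgM => //.
    by apply: (@cvg_EP _ _ Q ps Qstoch _ _ _ dev) => s' vs'; exact: Hf.
  (* Expectation leaves [ref] unchanged, so subtracting it from the fixed-point equation leaves the
     gain [(1 - al n) * ref (al n) (sXh s)]. *)
  have E : (fun n => (1 - al n) * ref (al n) (sXh s) + dev n s) =
    (fun n => Num.min (stage_cost D g lam s false + al n * EP Q ps s false (dev n))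
                      (stage_cost D g lam s true + al n * EP Q ps s true (dev n))).
    apply/funext => n; rewrite /dev discounted_value_fix// /discounted_op.
    have EPV b : stage_cost D g lam s b + al n * EP Q ps s b (V (al n)) =
       (stage_cost D g lam s b + al n * EP Q ps s b (dev n)) + al n * ref (al n) (sXh s).
      by rewrite /dev EPB EP_estimate//; ring.
    rewrite !EPV -addr_minl; set m := Num.min _ _; ring.
  by rewrite E in c1; exact: (cvg_unique (@Rhausdorff R) c1 (cvg_minr (EPc false) (EPc true))).
- move=> i j d d' vd vd' dd'.
  apply: (ler_cvg_to (Hf _ vd) (Hf _ vd')); apply: nearW => n.
  by rewrite /dev lerD2r; exact: discounted_value_age.
Qed.

End BoundedGrowth.
End Discounted.

(** * Monotone relative values and thresholds *)

Section Switching.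
Variables (R : realType) (M : nat) (Q : 'M[R]_M) (ps : R).
Variables (D : 'I_M -> 'I_M -> R) (g : 'I_M -> 'I_M -> nat -> R) (lam : R).
Hypotheses (Qstoch : stochastic Q) (ps01 : 0 <= ps <= 1) (lam_ge0 : 0 <= lam).
Variable f : state M -> R.
Hypothesis f_age : forall i j d d', valid_state Q (i, j, d) -> valid_state Q (i, j, d') ->
  (d <= d')%N -> f (i, j, d) <= f (i, j, d').

(** Each valid state lies above its base state, and there are finitely many of these. *)
Lemma age_monotone_lower_bound : exists K, forall s, valid_state Q s -> - K <= f s.
Proof.
exists (\sum_x `|f (base x.1 x.2)|) => -[[i j] d] vs.
rewrite lerNl; apply: le_trans (_ : `|f (base i j)| <= _); last first.
  by rewrite (bigD1 (i, j))//= lerDl; exact: sumr_ge0.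
rewrite lerNl; apply: le_trans (_ : f (base i j) <= _).
  by rewrite lerNl -normrN; exact: ler_norm.
by apply: f_age => //; [exact: valid_base|exact: valid_age vs].
Qed.

(** Each stage collects one gain, whose expectation the moves preserve; the lower bound on [f]
    disposes of the terminal value. *)
Lemma relative_value_verification (sigma : state M -> bool) (rho : 'I_M -> R) K :
  (forall e e', ps * rho e = ps * rho e') ->
  (forall s, valid_state Q s -> rho (sXh s) + f s = Qfac Q ps D g lam f s (sigma s)) ->
  (forall s, valid_state Q s -> - K <= f s) ->
  forall n s, valid_state Q s ->
    exp_cost Q ps D g lam (stationary R sigma) n [::] s <= n%:R * rho (sXh s) + (f s + K).
Proof.
move=> psrho rhof fK; elim=> [|n IH] s vs; first by rewrite mul0r add0r -lerBlDr sub0r fK.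
rewrite exp_costS; apply: le_trans (_ : stage_cost D g lam s (sigma s) +
    EP Q ps s (sigma s) (fun s' => n%:R * rho (sXh s') + (f s' + K)) <= _).
  by rewrite lerD2l; apply: ler_EP => // s' vs'; exact: IH.
rewrite !EPD EPZ EP_estimate// EP_cst// -natr1 mulrDl mul1r.
have := rhof s vs; rewrite /Qfac; move: (EP _ _ _ _ _) (stage_cost _ _ _ _ _) => x y E; lra.
Qed.

(* Transmitting pays off iff the expected continuation without transmission
   exceeds an age-independent constant, and that continuation grows with the age. *)
Lemma transmit_preference_age i j d d' : i != j ->
  valid_state Q (i, j, d) -> valid_state Q (i, j, d') -> (d <= d')%N ->
  Qfac Q ps D g lam f (i, j, d) true <= Qfac Q ps D g lam f (i, j, d) false ->
  Qfac Q ps D g lam f (i, j, d') true <= Qfac Q ps D g lam f (i, j, d') false.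
Proof.
move=> ij vd vd' dd'; rewrite /Qfac /stage_cost !EP_transmit !EP_error//.
have Qf : Q i i * f (i, j, d.+1) <= Q i i * f (i, j, d'.+1).
  have [Q_ge0 _] := Qstoch; have := Q_ge0 i i.
  rewrite le_eqVlt => /predU1P[<-|Qii]; first by rewrite !mul0r.
  by apply: ler_wpM2l => //; apply: f_age; rewrite ?ltnS//; exact: valid_error.
have /andP[ps0 _] := ps01; have := ler_wpM2l ps0 Qf.
rewrite !mulrDr /sX /=.
set x := Q i i * f (i, j, d.+1); set y := Q i i * f (i, j, d'.+1).
by set u := \sum_(k < M) _; set v := \sum_(k < M | _) _; lra.
Qed.

(** The threshold is the least valid age at which transmitting is no worse;
    [transmit_preference_age] covers all larger ages. *)
Lemma switching_structure : exists tau : 'I_M -> 'I_M -> option nat,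
  (forall i j t, tau i j = Some t -> (1 <= t)%N) /\
  attains_min Q ps D g lam f (threshold_policy tau).
Proof.
pose pays i j t := `[< (1 <= t)%N /\ valid_state Q (i, j, t) /\
  Qfac Q ps D g lam f (i, j, t) true <= Qfac Q ps D g lam f (i, j, t) false >].
have /choice[tau Htau] : forall x : 'I_M * 'I_M, exists o : option nat,
    if o is Some t then pays x.1 x.2 t /\ forall t', pays x.1 x.2 t' -> (t <= t')%N
    else forall t, ~~ pays x.1 x.2 t.
  move=> [i j]; have [ex|noex] := pselect (exists t, pays i j t).
    by exists (Some (ex_minn ex)); case: ex_minnP.
  by exists None => t; apply/negP => pt; apply: noex; exists t.
exists (fun i j => tau (i, j)); split.
  by move=> i j t E; have := Htau (i, j); rewrite E => -[/asboolP[]].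
move=> [[i j] d] vs; rewrite /threshold_policy /sX /sXh /sD /=.
have [ij|ij] := eqVneq i j.
  apply/esym/min_l; rewrite /Qfac [EP _ _ _ true _]EP_sync//.
  by rewrite lerD2r /stage_cost mulr0 mulr1 lerD2l.
have d1 : (1 <= d)%N by case: vs => [[/= /eqP]|[_ []]//]; rewrite (negbTE ij).
have idle : ~~ pays i j d ->
    Qfac Q ps D g lam f (i, j, d) false <= Qfac Q ps D g lam f (i, j, d) true.
  by move=> np; rewrite leNgt; apply: contra np => /ltW lt; apply/asboolP.
have := Htau (i, j); case: (tau (i, j)) => [t /= [/asboolP[_ [vt pt]] tmin]|/= none].
  have [td|dt] := leqP t d; first by apply/esym/min_r; exact: transmit_preference_age pt.
  by apply/esym/min_l/idle/negP => /tmin; rewrite leqNgt dt.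
by apply/esym/min_l/idle.
Qed.

End Switching.

(** * Optimality of the threshold policy *)

Theorem theorem2 (R : realType) (M : nat) (Q : 'M[R]_M) (ps : R)
  (D : 'I_M -> 'I_M -> R) (g : 'I_M -> 'I_M -> nat -> R) (lam : R) :
  stochastic Q -> irreducible Q -> (exists i, in_Xap Q i) ->
  0 <= ps <= 1 ->
  (forall i j, i != j -> 0 < D i j) ->
  (forall i j n, 0 <= g i j n) ->
  (forall i j m n, (m <= n)%N -> g i j m <= g i j n) ->
  0 <= lam ->
  (exists (Lbar : R) (h : state M -> R) (sigma : state M -> bool),
      (forall s1, valid_state Q s1 -> opt_cost Q ps D g lam s1 = Lbar%:E) /\
      bellman Q ps D g lam Lbar h /\ attains_min Q ps D g lam h sigma /\
      optimal_sd Q ps D g lam sigma) ->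
  exists tau : 'I_M -> 'I_M -> option nat,
    (forall i j t, tau i j = Some t -> (1 <= t)%N) /\
    optimal_sd Q ps D g lam (threshold_policy tau) /\
    exists (Lbar : R) (h : state M -> R),
      (forall s1, valid_state Q s1 -> opt_cost Q ps D g lam s1 = Lbar%:E) /\
      bellman Q ps D g lam Lbar h /\
      attains_min Q ps D g lam h (threshold_policy tau).
Proof.
move=> Qstoch Qirr Qap ps01 D_gt0 g_ge0 g_homo lam_ge0.
move=> [L [h [sigma [optL [bell [att opt_sigma]]]]]].
have C_ge0 n s : 0 <= exp_cost Q ps D g lam (stationary R sigma) n [::] s.
  exact: exp_cost_ge0.
have L_ge0 : 0 <= L.
  have [r _] := Qap; have vr := valid_sync Q r.
  rewrite -lee_fin -(optL _ vr) -(opt_sigma _ vr).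
  by apply: limf_esup_ge0 => [/filter_not_empty//|n]; rewrite lee_fin divr_ge0.
have growth s A : valid_state Q s -> L < A ->
    exists K, forall n, exp_cost Q ps D g lam (stationary R sigma) n [::] s <= A * n%:R + K.
  move=> vs LA; apply: (@limn_esup_lt_linear _ _ L) => //; first exact: exp_cost_homo.
  by rewrite -(optL _ vs) -(opt_sigma _ vs).
have [rho [f [rho_le psrho rhof f_age]]] := vanishing_discount Qstoch ps01 D_gt0
  g_ge0 g_homo lam_ge0 L_ge0 growth Qirr Qap bell att.
have [tau [tau1 att_tau]] := switching_structure D g Qstoch ps01 lam_ge0 f_age.
have [K fK] := age_monotone_lower_bound f_age.
have avg_le s : valid_state Q s ->
    (avg_cost Q ps D g lam (stationary R (threshold_policy tau)) s <= (rho (sXh s))%:E)%E.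
  move=> vs; apply: (@linear_limn_esup_le _ _ _ (f s + K)) => n.
  apply: relative_value_verification => // s' vs'.
  by rewrite rhof// att_tau.
have avg_ge s : valid_state Q s ->
    (L%:E <= avg_cost Q ps D g lam (stationary R (threshold_policy tau)) s)%E.
  move=> vs; rewrite -(optL _ vs); apply: ereal_inf_lbound.
  exists (stationary R (threshold_policy tau)) => //.
  by move=> hs s'; rewrite /stationary; case: threshold_policy; rewrite /= ?lexx ler01.
(* The average cost lies between the infimum [L] and [rho (sXh s)], which is at most [L]; this
   removes the dependence on the estimate. *)
have rhoL s : valid_state Q s -> rho (sXh s) = L.
  move=> vs; apply/eqP; rewrite eq_le rho_le -lee_fin.
  exact: le_trans (avg_ge s vs) (avg_le s vs).
exists tau; split => //; split.
  move=> s vs; rewrite (optL s vs); apply/eqP; rewrite eq_le avg_ge// andbT.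
  by rewrite -(rhoL s vs) avg_le.
exists L, f; split => //; split => // s vs.
by rewrite -(rhoL s vs) rhof.
Qed.
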